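(* The estimator $\hat{u}=(X_t)_{t\in[0,T]}$ is minimax: for all $u\in\Omega$, $$\mathrm{R}(\gamma,\mu,\hat{u})=\mathbb{E}_u\left[\int_0^T |X_t-u_t|^2\,\mu(dt)\right]=\inf_{\xi}\ \sup_{v\in\Omega}\ \mathbb{E}_v\left[\int_0^T|\xi_t-v_t|^2\,\mu(dt)\right],$$ where the infimum is over all drift estimators $\xi=(\xi_t)_{t\in[0,T]}$ (no adaptedness or unbiasedness is required of $\xi$) and $\mathrm{R}(\gamma,\mu,\hat{u})=\int_0^T\gamma(t,t)\,\mu(dt)$.
   Context: Let $T>0$ and let $\mu$ be a finite Borel measure on $[0,T]$. $X=(X_t)_{t\in[0,T]}$ is a real-valued centered Gaussian process on a probability space $(\Omega,\mathcal{F},\mathbb{P})$, with $\mathcal{F}$ generated by $X$, and with covariance $$\gamma(s,t)=\mathbb{E}[X_sX_t]=\int_0^{s\wedge t}K(t,r)K(s,r)\,dr,\qquad s,t\in[0,T],$$ where $K(\cdot,\cdot)$ is a deterministic kernel such that $(Kh)(t):=\int_0^tK(t,s)\dot h(s)\,ds$ is differentiable in $t\in[0,T]$. Path space convention: $\Omega$ is a vector space of functions $\omega:[0,T]\to\mathbb{R}$ containing all continuous functions vanishing at $0$, $X$ is the canonical process $X_t(\omega)=\omega(t)$ (assumed jointly measurable in $(t,\omega)$), and for $u\in\Omega$ we write $u_t=u(t)$. For $u\in\Omega$, $\mathbb{P}_u$ is the translation of $\mathbb{P}$ by $u$, i.e. the probability on $\Omega$ under which $X_t=u_t+X^u_t$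 with $(X^u_t)_{t\in[0,T]}$ a centered Gaussian process with covariance $\gamma$; $\mathbb{E}_u$ is the expectation under $\mathbb{P}_u$. A drift estimator is a measurable process $\xi=(\xi_t)_{t\in[0,T]}$ on $(\Omega,\mathcal{F})$, i.e. a measurable functional of the observed path $X$ (not depending on the unknown drift). *)

(* Defs.v *)
From HB Require Import structures.
From mathcomp Require Import all_boot all_order all_algebra.
From mathcomp Require Import all_classical all_reals all_analysis.
From mathcomp Require Import measurable_realfun.

Set Implicit Arguments.
Unset Strict Implicit.
Unset Printing Implicit Defensive.

Import Order.TTheory GRing.Theory Num.Theory.
Import numFieldNormedType.Exports.

Local Open Scope classical_set_scope.
Local Open Scope ring_scope.

(* A function on [0, T] is encoded as the function on R that extends it by 0,
   so distinct elements of [paths] are distinct functions on [0, T]. *)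
Record pathSpace (R : realType) (T : R) := PathSpace {
  paths : set (R -> R);
  paths_out : forall w, paths w ->
    forall t : R, ~ `[0, T]%classic t -> w t = 0;
  paths0 : paths (fun=> 0);
  pathsD : forall w1 w2, paths w1 -> paths w2 ->
    paths (fun t => w1 t + w2 t);
  pathsZ : forall (a : R) w, paths w -> paths (fun t => a * w t);
  paths_continuous : forall f : R -> R,
    {within `[0, T], continuous f} -> f 0 = 0 -> paths (patch (fun=> 0) `[0, T] f)
}.

Section path_space.
Context {R : realType} {T : R} (W : pathSpace T).

Definition pathType : Type := set_type (paths W).

Definition zero_path : pathType := SigSub (mem_set (paths0 W)).

HB.instance Definition _ := Choice.on pathType.

HB.instance Definition _ := isPointed.Build pathType zero_path.

Definition canonical_process (t : R) (w : pathType) : R := val w t.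

Definition coord_events : set (set pathType) :=
  \bigcup_(t in `[0, T])
    preimage_set_system setT (canonical_process t) measurable.

(* Omega with the sigma-algebra generated by the canonical process. *)
Definition pathOmega := g_sigma_algebraType coord_events.

Definition shift_path (v w : pathOmega) : pathOmega :=
  SigSub (mem_set (pathsD (set_valP v) (set_valP w))).

Lemma canonical_process_shift v w t :
  canonical_process t (shift_path v w) =
  canonical_process t v + canonical_process t w.
Proof. by []. Qed.

Lemma measurable_canonical_process t : `[0, T]%classic t ->
  measurable_fun [set: pathOmega] (canonical_process t).
Proof.
by move=> tT _ B mB; apply: sub_sigma_algebra; exists t => //; exists B.
Qed.

Lemma measurable_shift_path v : measurable_fun setT (shift_path v).
Proof.
apply: (@measurability _ _ pathOmega pathOmega _ _ coord_events) => //.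
move=> _ [_ [t tT [B mB <-]] <-].
rewrite !setTI -comp_preimage -[X in measurable X]setTI.
have : measurable_fun setT
    (fun w : pathOmega => canonical_process t v + canonical_process t w).
  apply: measurable_funD; first exact: measurable_cst.
  exact: measurable_canonical_process.
exact.
Qed.

HB.instance Definition _ v :=
  isMeasurableFun.Build _ _ _ _ (shift_path v) (measurable_shift_path v).

(* P_v: under it, the canonical process is v plus a process of law P. *)
Definition translated (P : probability pathOmega R) (v : pathOmega)
  : probability pathOmega R := distribution P (shift_path v).

Definition measurable_process (xi : R -> pathOmega -> R) : Prop :=
  measurable_fun (`[0, T] `*` [set: pathOmega])
    (fun p : measurableTypeR R * pathOmega => xi p.1 p.2).

(* Only the restriction of mu to [0, T] is used, and every finite Borel
   measure on [0, T] is such a restriction. *)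
Definition risk (P : probability pathOmega R)
    (mu : {finite_measure set (measurableTypeR R) -> \bar R})
    (xi : R -> pathOmega -> R) (v : pathOmega) : \bar R :=
  (\int[translated P v]_w
     \int[mu]_(t in `[0%R, T]) (`|xi t w - canonical_process t v| ^+ 2)%:E)%E.

End path_space.

(* The degenerate case is separate because [normal_prob m 0] is not a Dirac
   mass. *)
Definition gaussian_rv d (Om : measurableType d) (R : realType)
    (P : probability Om R) (Y : Om -> R) : Prop :=
  exists m s : R, forall A : set R, measurable A ->
    P (Y @^-1` A) = if s == 0 then \d_m A else normal_prob m s A.

Record centered_gaussian_process d (Om : measurableType d) (R : realType)
    (P : probability Om R) (I : set R) (X : R -> Om -> R) (g : R -> R -> R)
    : Prop := CenteredGaussianProcess {
  process_measurable : forall t, I t -> measurable_fun setT (X t);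
  process_gaussian : forall n (a t : 'I_n -> R), (forall i, I (t i)) ->
    gaussian_rv P (fun w => \sum_(i < n) a i * X (t i) w);
  process_centered : forall t, I t -> ('E_P[X t] = 0)%E;
  process_cov : forall s t, I s -> I t -> ('E_P[X s \* X t] = (g s t)%:E)%E
}.

Section kernel.
Context {R : realType}.
Implicit Types (T : R) (K : R -> R -> R).
Local Notation leb := (@lebesgue_measure R).

Definition kernel_cov K (s t : R) : R :=
  \int[leb]_(r in `[0, Num.min s t]) (K t r * K s r).

(* Kh, as a function of the derivative dh of h. *)
Definition kernel_op K (dh : R -> R) (t : R) : R :=
  \int[leb]_(s in `[0, t]) (K t s * dh s).

(* f'(t) = l for f seen as a function on [0, T] (one-sided at 0 and T). *)
Definition has_deriv_on T (f : R -> R) (t l : R) : Prop :=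
  (s - t)^-1 * (f s - f t) @[s --> within `[0, T] t^'] --> l.

(* The first two fields are what the integrals defining the covariance and Kh
   need; h ranges over the continuously differentiable functions, so that
   K = 1 (Brownian motion), for which Kh = h - h(0), is allowed. *)
Record drift_kernel T K : Prop := DriftKernel {
  kernel_measurable : forall t : R, `[0, T]%classic t ->
    measurable_fun `[0, t] (K t);
  kernel_square_integrable : forall t : R, `[0, T]%classic t ->
    leb.-integrable `[0, t] (fun r => (K t r ^+ 2)%:E);
  kernel_differentiable : forall h dh : R -> R,
    (forall t : R, `[0, T]%classic t -> has_deriv_on T h t (dh t)) ->
    {within `[0, T], continuous dh} ->
    forall t : R, `[0, T]%classic t ->
      exists l, has_deriv_on T (kernel_op K dh) t l
}.

End kernel.

(* Main.v *)
Require Import Defs.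
From HB Require Import structures.
From mathcomp Require Import all_boot all_order all_algebra.
From mathcomp Require Import all_classical all_reals all_analysis.
From mathcomp Require Import measurable_realfun ring lra.
Set Implicit Arguments.
Unset Strict Implicit.
Unset Printing Implicit Defensive.
Import Order.TTheory GRing.Theory Num.Theory.
Import numFieldNormedType.Exports.
Local Open Scope classical_set_scope.
Local Open Scope ring_scope.

(** The observation itself has constant risk, the integral of the variance, by
    Tonelli ([risk_canonical]), so the whole difficulty is that no estimator has
    a smaller worst-case risk.  The worst-case risk dominates the risk averaged
    over any random drift.  Take as drift [c] times a path [X'] drawn from the
    law of the noise, independently of the noise [X]: the paths form a vector
    space, so this drift is admissible.  With [a ^+ 2 + b ^+ 2 = 1] and
    [c = b / a], put [Y = a X + b X'] and [Z = b X - a X'].  Then the observation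
    [X + c X'] is [Y / a], while the drift is [c b Y - b Z].  The pair [(Y, Z)]
    has the law of [(X, X')], that is, [Z] is a centred noise independent of the
    observation; whatever is estimated from [Y], the mean square error at time
    [t] is then at least [b ^+ 2] times the variance at [t] ([bayes_bound]).
    Letting [b] tend to 1 gives the theorem.

    The rotation invariance of the law of [(X, X')] on the product of two path
    spaces ([path_rot_invariant]) is the one substantial ingredient.  Linear
    functionals of the pair are sums of two independent centred normal
    variables, whose law depends on the total variance only
    ([centered_normal_sum_eq], from a computation with the normal density), and
    a rotation keeps the total variance.  Hence the expectations of cosines of
    linear functionals agree.  Products of cosines being sums of cosines, the
    functions obtained from these by linear combinations and bounded limits form
    an algebra; it contains the indicators of half-spaces, hence those of all
    events of the product sigma-algebra ([trig_eq_measure]). *)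

(** * The normal law *)

Section normal_law.
Context {R : realType}.
Implicit Types (m s t : R) (f : R -> R).
Local Notation leb := (@lebesgue_measure R).

(** Holds because the density is, up to a null set, the Radon-Nikodym derivative
    of the law. *)
Lemma ge0_integral_normal_prob m s (f : R -> \bar R) :
  measurable_fun [set: R] f -> (forall x, (0 <= f x)%E) ->
  (\int[normal_prob m s]_x f x =
   \int[leb]_x (f x * (normal_pdf m s x)%:E))%E.
Proof.
move=> mf f0.
pose nu : {finite_measure set (measurableTypeR R) -> \bar R} := normal_prob m s.
have dom : nu `<< leb by exact: normal_prob_dominates.
rewrite -[LHS](@Radon_Nikodym_SigmaFinite.change_of_variables _ _ _ nu leb dom)//.
have mRN := measurable_int _ (Radon_Nikodym_SigmaFinite.f_integrable dom).
have mpdf : measurable_fun [set: R] (EFin \o normal_pdf m s).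
  by apply/measurable_EFinP; exact: measurable_normal_pdf.
apply: ge0_ae_eq_integral => //.
- exact: emeasurable_funM.
- exact: emeasurable_funM.
- by move=> x _; rewrite mule_ge0 ?Radon_Nikodym_SigmaFinite.f_ge0.
- by move=> x _; rewrite mule_ge0 ?lee_fin ?normal_pdf_ge0.
- apply: ae_eqe_mul2l.
apply: integral_ae_eq => //.
  exact: Radon_Nikodym_SigmaFinite.f_integrable.
by move=> E _ mE; rewrite -Radon_Nikodym_SigmaFinite.f_integral.
Qed.

Lemma ge0_integral_affine (a b : R) f : 0 < a -> continuous f ->
  (forall x, 0 <= f x) ->
  (\int[leb]_x (f x)%:E = \int[leb]_x (f (a * x + b) * a)%:E)%E.
Proof.
move=> a0 cf f0.
pose F (x : R^o) := a * x + b.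
have F' : F^`()%classic = cst a.
  apply/funext => x; rewrite /F derive1E deriveD// deriveM// !derive_cst.
  by rewrite derive_id scaler0 !addr0 [_ *: _]mulr1.
rewrite (increasing_ge0_integration_by_substitutionT (F := F))//.
- by rewrite F'.
- by move=> x y xy; rewrite /F ltrD2r ltr_pM2l.
- by rewrite F' => x; exact: cvg_cst.
- by rewrite F'; exact: is_cvg_cst.
- by rewrite F'; exact: is_cvg_cst.
- apply: (cvg_comp (fun x => a * x) (fun y => y + b)); last exact: cvg_addrr_Ny.
  exact/gt0_cvgMrNy.
- apply: (cvg_comp (fun x => a * x) (fun y => y + b)); last exact: cvg_addrr.
  exact/gt0_cvgMry.
Qed.

Lemma std_normal_pdfE (x : R) :
  normal_pdf 0 1 x = normal_peak 1 * expR (- (x ^+ 2 / 2)).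
Proof.
rewrite normal_pdfE ?oner_neq0// /normal_fun subr0 expr1n mulNr.
by rewrite -[_ *+ 2]mulr_natr mul1r.
Qed.

Lemma normal_pdf_affine m s x : 0 < s ->
  normal_pdf m s (s * x + m) * s = normal_pdf 0 1 x.
Proof.
move=> s0; have sN0 : s != 0 by rewrite gt_eqF.
rewrite std_normal_pdfE normal_pdfE// /normal_fun addrK.
have -> : normal_peak s = normal_peak 1 / s.
  rewrite /normal_peak -mulrnAr sqrtrM ?sqr_ge0// sqrtr_sqr gtr0_norm//.
  by rewrite expr1n mul1r invfM mulrC.
rewrite mulrAC divfK//; congr (_ * expR _).
by rewrite -mulr_natr; field; rewrite sN0.
Qed.

Lemma ge0_integral_normal_std m s f : 0 < s -> continuous f ->
  (forall x, 0 <= f x) ->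
  (\int[normal_prob m s]_x (f x)%:E
   = \int[normal_prob 0 1]_x (f (s * x + m))%:E)%E.
Proof.
move=> s0 cf f0.
have mf : measurable_fun [set: R] f by exact: continuous_measurable_fun.
have sN0 : s != 0 by rewrite gt_eqF.
have mEf : measurable_fun [set: R] (EFin \o f) by exact/measurable_EFinP.
have mfa : measurable_fun [set: R] (fun x => (f (s * x + m))%:E).
  apply: (measurableT_comp mEf).
  by apply: measurable_funD => //; exact: measurable_funM.
have Ef0 x : (0 <= (f x)%:E)%E by rewrite lee_fin.
rewrite (ge0_integral_normal_prob m s mEf Ef0).
rewrite (ge0_integral_normal_prob 0 1 mfa (fun x => Ef0 _)).
under eq_integral do rewrite -EFinM.
rewrite (@ge0_integral_affine s m (fun x => f x * normal_pdf m s x)).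
- by apply: eq_integral => x _; rewrite -EFinM -mulrA normal_pdf_affine.
- exact: s0.
- by move=> x; apply: cvgM; [exact: cf|exact: continuous_normal_pdf].
- by move=> x; rewrite mulr_ge0// normal_pdf_ge0.
Qed.

Lemma std_normal_pdfN x : normal_pdf (R := R) 0 1 (- x) = normal_pdf 0 1 x.
Proof. by rewrite !std_normal_pdfE sqrrN. Qed.

Lemma std_normal_integralN (f : R -> \bar R) : measurable_fun [set: R] f ->
  (forall x, (0 <= f x)%E) ->
  (\int[normal_prob 0%R (1 : R)]_x f (- x)%R
   = \int[normal_prob 0%R (1 : R)]_x f x)%E.
Proof.
move=> mf f0.
have mpdf : measurable_fun [set: R] (EFin \o normal_pdf 0 1).
  by apply/measurable_EFinP; exact: measurable_normal_pdf.
have mfN : measurable_fun [set: R] (fun x => f (- x)) by exact: measurableT_comp.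
rewrite (ge0_integral_normal_prob 0 1 mfN (fun x => f0 _)).
rewrite (ge0_integral_normal_prob 0 1 mf f0).
have mh : measurable_fun [set: measurableTypeR R] (fun x => f x * (normal_pdf 0 1 x)%:E)%E.
  exact: emeasurable_funM.
transitivity (\int[pushforward leb (-%R : R -> measurableTypeR R)]_x
    (f x * (normal_pdf 0 1 x)%:E))%E; last first.
  by apply: eq_measure_integral => A mA _; exact: lebesgue_measureN.
have h0 : {in [set: measurableTypeR R], forall x, (0 <= f x * (normal_pdf 0 1 x)%:E)%E}.
  by move=> x _; rewrite mule_ge0// lee_fin normal_pdf_ge0.
have mN : measurable_fun [set: measurableTypeR R]
  (-%R : measurableTypeR R -> measurableTypeR R) by [].
have := ge0_integral_pushforward mN leb measurableT mh h0.
rewrite preimage_setT => ->.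
by apply: eq_integral => x _; rewrite /= std_normal_pdfN.
Qed.

(** The sum of two independent centred normal variables is normal: completing
    the square turns [x ^+ 2 + y ^+ 2] on the line [s x + t y = r u] into
    [u ^+ 2] plus a square in which [x] is affine. *)
Lemma std_normal_convolution s t r f : 0 < t -> 0 < r ->
  r ^+ 2 = s ^+ 2 + t ^+ 2 -> continuous f -> (forall x, 0 <= f x) ->
  (\int[normal_prob 0%R (1 : R)]_x \int[normal_prob 0%R (1 : R)]_y (f (s * x + t * y))%:E
   = \int[normal_prob 0 1]_u (f (r * u))%:E)%E.
Proof.
move=> t0 r0 rst cf f0.
have mf : measurable_fun [set: R] f by exact: continuous_measurable_fun.
have tN0 : t != 0 by rewrite gt_eqF.
have rN0 : r != 0 by rewrite gt_eqF.
pose phi : R -> R := normal_pdf 0 1.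
have mphi : measurable_fun [set: R] phi by exact: measurable_normal_pdf.
have cphi : continuous phi by apply: continuous_normal_pdf; rewrite oner_neq0.
have phi0 x : 0 <= phi x by exact: normal_pdf_ge0.
(* The value of [y] for which [s * x + t * y = r * u]. *)
pose g (x u : R) : R := r / t * u - s / t * x.
pose h (p : R * R) : R := f (r * p.2) * phi p.2 * (phi (g p.2 p.1) * (r / t)).
have rt0 : 0 < r / t by rewrite divr_gt0.
have h0 p : (0 <= (h p)%:E)%E.
  by rewrite lee_fin /h; apply: mulr_ge0; apply: mulr_ge0 => //; exact: ltW.
have mh : measurable_fun [set: R * R] (EFin \o h).
  apply/measurable_EFinP; rewrite /h; apply: measurable_funM.
    apply: measurable_funM; apply: measurableT_comp => //.
    exact: measurable_funM.
  apply: measurable_funM => //; apply: measurableT_comp => //.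
  by apply: measurable_funB; exact: measurable_funM.
have Ef0 x : (0 <= (f x)%:E)%E by rewrite lee_fin.
have maff (a b : R) : measurable_fun [set: R] (fun x => a * x + b).
  by apply: measurable_funD => //; exact: measurable_funM.
have maff2 (a b c d : R) :
    measurable_fun [set: R] (fun x => a + b * (c * x + d)).
  by apply: measurable_funD => //; exact: measurable_funM.
have step x : (\int[normal_prob 0 1]_y (f (s * x + t * y))%:E * (phi x)%:E
               = \int[leb]_u (h (x, u))%:E)%E.
  have mfx : measurable_fun [set: R] (fun y => (f (s * x + t * y))%:E).
    apply/measurable_EFinP; apply: measurableT_comp => //.
    by apply: measurable_funD => //; exact: measurable_funM.
  rewrite (ge0_integral_normal_prob 0 1 mfx (fun y => Ef0 _)).
  under eq_integral do rewrite -EFinM.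
  rewrite (@ge0_integral_affine (r / t) (- (s / t * x))
    (fun y => f (s * x + t * y) * phi y) rt0); last 2 first.
  - move=> y; apply: cvgM; last exact: cphi.
    apply: (continuous_comp (f := fun y => s * x + t * y)); last exact: cf.
    by apply: cvgD; [exact: cvg_cst|apply: cvgM; [exact: cvg_cst|exact: cvg_id]].
  - by move=> y; rewrite mulr_ge0.
  rewrite muleC -ge0_integralZl_EFin; last 4 first.
  - exact: measurableT.
  - by move=> u _; rewrite lee_fin; apply: mulr_ge0; [exact: mulr_ge0|exact: ltW].
  - apply/measurable_EFinP; apply: measurable_funM => //; apply: measurable_funM.
      exact: (measurableT_comp mf (maff2 (s * x) t (r / t) (- (s / t * x)))).
    exact: (measurableT_comp mphi (maff (r / t) (- (s / t * x)))).
  - exact: phi0.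
  apply: eq_integral => u _; rewrite -EFinM; congr EFin; rewrite /h /g /=.
  have -> : s * x + t * (r / t * u - s / t * x) = r * u by field.
  rewrite mulrC -[LHS]mulrA -[LHS]mulrA -[RHS]mulrA; congr (_ * _).
  rewrite /phi !std_normal_pdfE.
  (* The substitution is a rotation, written without its angle. *)
  have key : (r / t * u - s / t * x) ^+ 2 + x ^+ 2
      = u ^+ 2 + (r / t * x - s / t * u) ^+ 2.
    have r2 : t ^+ 2 = r ^+ 2 - s ^+ 2 by rewrite rst; ring.
    apply: (mulIf (x := t ^+ 2)); first by rewrite expf_neq0.
    transitivity ((r * u - s * x) ^+ 2 + x ^+ 2 * t ^+ 2); first by field.
    transitivity (u ^+ 2 * t ^+ 2 + (r * x - s * u) ^+ 2); last by field.
    by rewrite r2; ring.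
  transitivity (normal_peak 1 ^+ 2 * expR (- (((r / t * u - s / t * x) ^+ 2
      + x ^+ 2) / 2)) * (r / t)).
    by rewrite mulrDl opprD expRD; ring.
  by rewrite key mulrDl opprD expRD; ring.
pose I x := (\int[normal_prob 0%R (1 : R)]_y (f (s * x + t * y))%:E)%E.
have mI : measurable_fun [set: R] I.
  have mf2 : measurable_fun [set: R * R] (fun p => (f (s * p.1 + t * p.2))%:E).
    apply/measurable_EFinP; apply: measurableT_comp => //.
    by apply: measurable_funD => //; exact: measurable_funM.
  exact: (@measurable_fun_fubini_tonelli_F _ _ _ _ _ (normal_prob 0 1) _ mf2 (fun p => Ef0 _)).
have I0 x : (0 <= I x)%E by apply: integral_ge0 => y _; exact: Ef0.
rewrite (ge0_integral_normal_prob 0 1 mI I0).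
under eq_integral do rewrite step.
apply: etrans (@fubini_tonelli _ _ (measurableTypeR R) (measurableTypeR R) R
  leb leb (EFin \o h) mh h0) _.
have mfr : measurable_fun [set: R] (fun u => (f (r * u))%:E).
  have mr : measurable_fun [set: R] (fun u => r * u) by exact: measurable_funM.
  by apply/measurable_EFinP; exact: (measurableT_comp mf mr).
rewrite (ge0_integral_normal_prob 0 1 mfr (fun y => Ef0 _)).
apply: eq_integral => u _; rewrite /h /=.
under eq_integral do rewrite EFinM.
rewrite ge0_integralZl_EFin; last 4 first.
- exact: measurableT.
- by move=> x _; rewrite lee_fin; apply: mulr_ge0 => //; exact: ltW.
- apply/measurable_EFinP; apply: measurable_funM => //.
  exact: (measurableT_comp mphi (maff (r / t) (- (s / t * u)))).
- exact: mulr_ge0.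
(* What remains is the integral of the density of [x], given [u]. *)
have := @ge0_integral_affine (r / t) (- (s / t * u)) phi rt0 cphi phi0.
by rewrite integral_normal_pdf => <-; rewrite mule1.
Qed.

End normal_law.

(** * Moments of the normal law and Gaussian variables *)

Section std_normal_moments.
Context {R : realType}.
Local Notation gauss := (normal_prob 0%R (1 : R)).

Lemma std_normal_integral_cst (k : R) : (\int[gauss]_x k%:E = k%:E)%E.
Proof.
rewrite integral_cst; last exact: measurableT.
transitivity (k%:E * 1)%E; last by rewrite mule1.
congr (_ * _)%E; exact: integral_normal_pdf.
Qed.

Definition std_normal_sqr : \bar R := (\int[gauss]_x (x ^+ 2)%:E)%E.

Let measurable_sqr : measurable_fun [set: R] (fun x => (x ^+ 2)%:E).
Proof. by apply/measurable_EFinP; exact: measurable_funX. Qed.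

Let sqr0 (x : R) : (0 <= (x ^+ 2)%:E)%E.
Proof. by rewrite lee_fin sqr_ge0. Qed.

(** Finite because [x ^+ 2 <= 4 * expR (x ^+ 2 / 4)], which turns the integrand
    into a multiple of a normal density of larger variance. *)
Lemma std_normal_sqr_lty : (std_normal_sqr < +oo)%E.
Proof.
rewrite /std_normal_sqr (ge0_integral_normal_prob 0 1 measurable_sqr sqr0).
pose v : R := Num.sqrt 2; have v0 : v != 0 by rewrite gt_eqF// sqrtr_gt0.
pose k : R := 4 * normal_peak 1 / normal_peak v.
have p0 : normal_peak v != 0 by rewrite gt_eqF// normal_peak_gt0.
have k0 : 0 <= k by rewrite /k !mulr_ge0 ?invr_ge0 ?normal_peak_ge0.
have mpdf (s : R) : measurable_fun [set: R] (EFin \o normal_pdf 0 s).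
  by apply/measurable_EFinP; exact: measurable_normal_pdf.
apply: (@le_lt_trans _ _ (\int[lebesgue_measure]_x (k%:E * (normal_pdf 0 v x)%:E))%E).
  apply: ge0_le_integral.
  - exact: measurableT.
  - by move=> x _; rewrite mule_ge0// lee_fin normal_pdf_ge0.
  - by apply: emeasurable_funM; [exact: measurable_sqr|exact: mpdf].
  - by apply: emeasurable_funM; [exact: measurable_cst|exact: mpdf].
  move=> x _; rewrite -!EFinM lee_fin std_normal_pdfE normal_pdfE// /normal_fun.
  set F := expR (- (x - 0) ^+ 2 / (v ^+ 2 *+ 2)).
  have -> : k * (normal_peak v * F) = normal_peak 1 * (4 * F).
    by rewrite /k; field.
  rewrite mulrCA ler_wpM2l ?normal_peak_ge0//.
  have FE : F = expR (- (x ^+ 2 / 4)).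
    rewrite /F subr0 sqr_sqrtr// -mulr_natr mulNr.
    by congr (expR (- (_ / _))); rewrite -natrM.
  have -> : expR (- (x ^+ 2 / 2)) = F * F.
    by rewrite FE -expRD; congr expR; field.
  rewrite mulrA ler_pM2r ?expR_gt0// FE expRN ler_pdivrMr ?expR_gt0//.
  have := expR_ge1Dx (x ^+ 2 / 4); lra.
rewrite ge0_integralZl_EFin; last 4 first.
- exact: measurableT.
- by move=> x _; rewrite lee_fin normal_pdf_ge0.
- exact: mpdf.
- exact: k0.
by rewrite integral_normal_pdf mule1 ltry.
Qed.

Lemma std_normal_sqr_gt0 : (0 < std_normal_sqr)%E.
Proof.
rewrite /std_normal_sqr (ge0_integral_normal_prob 0 1 measurable_sqr sqr0).
have mpdf : measurable_fun [set: R] (EFin \o normal_pdf 0 1).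
  by apply/measurable_EFinP; exact: measurable_normal_pdf.
have h0 (x : R) : (0 <= (x ^+ 2)%:E * (normal_pdf 0 1 x)%:E)%E.
  by rewrite mule_ge0// lee_fin normal_pdf_ge0.
have mh : measurable_fun [set: R] (fun x => (x ^+ 2)%:E * (normal_pdf 0 1 x)%:E)%E.
  by apply: emeasurable_funM; [exact: measurable_sqr|exact: mpdf].
have p0 : 0 < normal_peak (1 : R) * expR (- 2).
  by rewrite mulr_gt0 ?expR_gt0// normal_peak_gt0// oner_neq0.
apply: (@lt_le_trans _ _ (\int[lebesgue_measure]_(x in `[1%R, 2%R])
    (normal_peak (1 : R) * expR (- 2))%:E)%E).
  rewrite integral_cst; last exact: measurable_itv.
  suff : (0 < (normal_peak (1 : R) * expR (- 2))%:E
      * lebesgue_measure `[1%R : R, 2%R]%classic)%E by [].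
  rewrite lebesgue_measure_itv/= lte_fin ltr1n.
  rewrite -EFinD -EFinM lte_fin; apply: mulr_gt0 => //; lra.
apply: (@le_trans _ _ (\int[lebesgue_measure]_(x in `[1%R, 2%R])
    ((x ^+ 2)%:E * (normal_pdf 0 1 x)%:E))%E); last first.
  exact: ge0_subset_integral.
apply: ge0_le_integral.
- exact: measurable_itv.
- by move=> x _; rewrite lee_fin ltW.
- exact: measurable_cst.
- exact: measurable_funTS.
move=> x; rewrite /= in_itv/= => /andP[x1 x2].
rewrite -EFinM lee_fin std_normal_pdfE mulrCA ler_pM2l ?normal_peak_gt0 ?oner_neq0//.
have xx : 1 <= x ^+ 2 <= 4 by nra.
case/andP: xx => xx1 xx2.
apply: (@le_trans _ _ (expR (- (x ^+ 2 / 2)))); first by rewrite ler_expR; lra.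
by rewrite ler_peMl// expR_ge0.
Qed.

End std_normal_moments.

Section gaussian_variable.
Context d (Om : measurableType d) (R : realType) (P : probability Om R).
Local Notation gauss := (normal_prob 0%R (1 : R)).
Implicit Types (m s : R) (Y : Om -> R) (f : R -> R).

Lemma normal_prob_norm m s : normal_prob m `|s| = normal_prob m s.
Proof.
apply/funext => A; apply: eq_integral => x _; congr EFin.
rewrite /normal_pdf normr_eq0; case: ifP => // _.
by rewrite /normal_peak /normal_fun real_normK// num_real.
Qed.

(** This covers the degenerate case too, with [s = 0]; nonnegative continuous
    functions are enough because only cosines, squares and absolute values are
    ever integrated. *)
Lemma gaussian_rv_std Y : measurable_fun setT Y -> gaussian_rv P Y ->
  exists m s : R, 0 <= s /\ forall f, continuous f -> (forall x, 0 <= f x) ->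
    (\int[P]_w (f (Y w))%:E
     = \int[normal_prob 0%R (1 : R)]_x (f (s * x + m)%R)%:E)%E.
Proof.
move=> mY [m [s gY]]; exists m, `|s|; split => // f cf f0.
have mEf : measurable_fun [set: measurableTypeR R] (fun y => (f y)%:E).
  by apply/measurable_EFinP; exact: continuous_measurable_fun.
have f0' : {in [set: measurableTypeR R], forall y, (0 <= (f y)%:E)%E}.
  by move=> y _; rewrite lee_fin.
have := ge0_integral_pushforward (mY : measurable_fun setT (Y : Om -> measurableTypeR R))
  P measurableT mEf f0'.
rewrite preimage_setT /comp => <-.
have [s0|s0] := eqVneq s 0.
  transitivity (\int[\d_(m : measurableTypeR R)]_y (f y)%:E)%E.
    by apply: eq_measure_integral => A mA _; have := gY A mA; rewrite s0 eqxx; exact.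
  rewrite integral_dirac// diracT mul1e s0 normr0.
  under eq_integral do rewrite mul0r add0r.
  by rewrite std_normal_integral_cst.
have ns0 : 0 < `|s| by rewrite normr_gt0.
rewrite -ge0_integral_normal_std// normal_prob_norm.
by apply: eq_measure_integral => A mA _; have := gY A mA; rewrite (negbTE s0); exact.
Qed.

(** Averaging [s x + m] and [s (- x) + m] leaves [m], whence [m = 0]. *)
Lemma centered_gaussian_rv_std Y : measurable_fun setT Y -> gaussian_rv P Y ->
    P.-integrable setT (EFin \o Y) -> (\int[P]_w (Y w)%:E = 0)%E ->
  exists s : R, 0 <= s /\ forall f, continuous f -> (forall x, 0 <= f x) ->
    (\int[P]_w (f (Y w))%:E
     = \int[normal_prob 0%R (1 : R)]_x (f (s * x)%R)%:E)%E.
Proof.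
move=> mY gY iY EY; have [m [s [s0 law]]] := gaussian_rv_std mY gY.
suff m0 : m = 0.
  exists s; split => // f cf f0; rewrite (law f cf f0).
  by apply: eq_integral => x _; rewrite m0 addr0.
pose g x := s * x + m.
have mg : measurable_fun [set: R] g.
  by apply: measurable_funD => //; exact: measurable_funM.
have mN : measurable_fun [set: R] (-%R : R -> R) by [].
have mgN : measurable_fun [set: R] (fun x => g (- x)).
  exact: (measurableT_comp mg mN).
have c_abs : continuous (fun y : R => `|y|) by exact: norm_continuous.
(* Nonnegative, hence covered by [law], and it recovers the expectation once
   the absolute first moment, which is finite, is subtracted. *)
pose k (y : R) := `|y| + y.
have ck : continuous k by move=> y; apply: cvgD; [exact: c_abs|exact: cvg_id].
have k0 y : 0 <= k y by rewrite /k -lerBlDr sub0r -normrN ler_norm.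
have Eabs : (\int[gauss]_x `|(g x)%:E| = \int[P]_w `|(Y w)%:E|)%E.
  by rewrite -(law (fun y => `|y|)).
have ig : gauss.-integrable setT (EFin \o g).
  apply/integrableP; split; first exact/measurable_EFinP.
  by rewrite Eabs; have /integrableP[] := iY.
have EabsN : (\int[gauss]_x `|(g (- x))%:E| = \int[gauss]_x `|(g x)%:E|)%E.
  have mag : measurable_fun [set: R] (fun x => `|(g x)%:E|%E).
    by apply/measurableT_comp => //; exact/measurable_EFinP.
  exact: (std_normal_integralN mag (fun x => abse_ge0 _)).
have igN : gauss.-integrable setT (EFin \o (fun x => g (- x))).
  apply/integrableP; split; first exact/measurable_EFinP.
  by rewrite EabsN; have /integrableP[] := ig.
have Ek d' (S : measurableType d') (nu : {measure set S -> \bar R}) (h : S -> R) :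
    nu.-integrable setT (EFin \o h) ->
    (\int[nu]_x (k (h x))%:E = \int[nu]_x `|(h x)%:E| + \int[nu]_x (h x)%:E)%E.
  move=> ih; rewrite -(integralD measurableT (integrable_abse ih) ih).
  by apply: eq_integral => x _; rewrite /k EFinD.
have cancel (a b : \bar R) : a \is a fin_num -> b \is a fin_num ->
    a = (a + b)%E -> b = 0%E.
  by case: a b => [a| |] [b| |]// _ _ []; rewrite -[LHS]addr0 => /addrI <-.
have fin_abs : (\int[P]_w `|(Y w)%:E|)%E \is a fin_num.
  by apply: integrable_fin_num => //; exact: integrable_abse.
have Eg : (\int[gauss]_x (g x)%:E = 0)%E.
  apply: cancel fin_abs (integrable_fin_num measurableT ig) _.
  have := Ek _ _ gauss g ig.
  by rewrite -(law k ck k0) (Ek _ _ P Y iY) EY adde0 Eabs.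
have EgN : (\int[gauss]_x (g (- x))%:E = 0)%E.
  apply: cancel fin_abs (integrable_fin_num measurableT igN) _.
  have := Ek _ _ gauss _ igN; rewrite EabsN Eabs => <-.
  have mkg : measurable_fun [set: R] (fun x => (k (g x))%:E).
    apply/measurable_EFinP; apply: measurableT_comp => //.
    exact: continuous_measurable_fun.
  have kg0 x : (0 <= (k (g x))%:E)%E by rewrite lee_fin.
  rewrite (std_normal_integralN mkg kg0) -(law k ck k0) (Ek _ _ P Y iY) EY.
  by rewrite adde0.
have : (\int[gauss]_x (m *+ 2)%:E = 0)%E.
  rewrite -[RHS]add0e -{1}Eg -EgN -(integralD measurableT ig igN).
  by apply: eq_integral => x _; rewrite -EFinD /g; congr EFin; ring.
by rewrite std_normal_integral_cst => -[] /eqP; rewrite mulrn_eq0/= => /eqP.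
Qed.

End gaussian_variable.

(** * Sums of two independent centred normal variables *)

Section independent_sum.
Context d (Om : measurableType d) (R : realType) (P : probability Om R).
Local Notation gauss := (normal_prob 0%R (1 : R)).
Implicit Types (s t : R) (U V Y : Om -> R) (f : R -> R).

(** For [s = 0] this says that [Y] is almost surely null. *)
Definition centered_normal Y s := 0 <= s /\
  forall f, continuous f -> (forall x, 0 <= f x) ->
  (\int[P]_w (f (Y w))%:E = \int[gauss]_x (f (s * x)%R)%:E)%E.

Lemma centered_normal_sqr Y s : centered_normal Y s ->
  (\int[P]_w (Y w ^+ 2)%:E = (s ^+ 2)%:E * std_normal_sqr (R := R))%E.
Proof.
move=> [s0 law]; rewrite (law (fun x => x ^+ 2)); last 2 first.
- by move=> x; exact: exprn_continuous.
- by move=> x; exact: sqr_ge0.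
rewrite /std_normal_sqr -ge0_integralZl_EFin; last 4 first.
- exact: measurableT.
- by move=> x _; rewrite lee_fin sqr_ge0.
- by apply/measurable_EFinP; exact: measurable_funX.
- exact: sqr_ge0.
by apply: eq_integral => x _; rewrite exprMn EFinM.
Qed.

(** Conditioning on either variable replaces it by a multiple of a standard
    normal one; what is left is the convolution of two normal laws. *)
Lemma centered_normal_sum U V s t r f : measurable_fun setT U ->
  measurable_fun setT V -> centered_normal U s -> centered_normal V t ->
  0 <= r -> r ^+ 2 = s ^+ 2 + t ^+ 2 ->
  continuous f -> (forall x, 0 <= f x) ->
  (\int[P]_w \int[P]_w' (f (U w + V w'))%:E
   = \int[gauss]_x (f (r * x)%R)%:E)%E.
Proof.
move=> mU mV [s0 lU] [t0 lV] r0 rst cf f0.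
have mf : measurable_fun [set: R] f by exact: continuous_measurable_fun.
have Ef0 x : (0 <= (f x)%:E)%E by rewrite lee_fin.
have cfD (a : R) : continuous (fun y => f (a + y)).
  move=> y; apply: (continuous_comp (f := fun y => a + y)); last exact: cf.
  by apply: cvgD; [exact: cvg_cst|exact: cvg_id].
have cfDr (a : R) : continuous (fun y => f (y + a)).
  by under eq_fun do rewrite addrC; exact: cfD.
(* First [V] is replaced inside; then, after an exchange, [U]. *)
have -> : (\int[P]_w \int[P]_w' (f (U w + V w'))%:E
    = \int[P]_w \int[gauss]_y (f (U w + t * y))%:E)%E.
  by apply: eq_integral => w _; rewrite (lV _ (cfD (U w)))// => x; exact: f0.
have mtm : measurable_fun [set: R] (fun y => t * y) by exact: measurable_funM.
have msm : measurable_fun [set: R] (fun y => s * y) by exact: measurable_funM.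
have m1 : measurable_fun [set: Om * R] (fun p => (f (U p.1 + t * p.2))%:E).
  apply/measurable_EFinP; apply: (measurableT_comp mf).
  apply: measurable_funD; first exact: (measurableT_comp mU).
  exact: (measurableT_comp mtm).
have m2 : measurable_fun [set: R * R] (fun p => (f (s * p.1 + t * p.2))%:E).
  apply/measurable_EFinP; apply: (measurableT_comp mf).
  apply: measurable_funD; first exact: (measurableT_comp msm).
  exact: (measurableT_comp mtm).
have -> := @fubini_tonelli _ _ _ _ R P gauss _ m1 (fun=> Ef0 _).
have -> : (\int[gauss]_y \int[P]_w (f (U w + t * y))%:E
    = \int[gauss]_y \int[gauss]_x (f (s * x + t * y))%:E)%E.
  by apply: eq_integral => y _; rewrite (lU _ (cfDr (t * y)))// => x; exact: f0.
have <- := @fubini_tonelli _ _ _ _ R gauss gauss _ m2 (fun=> Ef0 _).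
have [tz|tN0] := eqVneq t 0.
  have -> : r = s.
    by apply/eqP; rewrite -(eqrXn2 (n := 2))// rst tz expr0n addr0.
  apply: eq_integral => x _; rewrite tz.
  transitivity (\int[gauss]_y (f (s * x))%:E)%E.
    by apply: eq_integral => y _; rewrite mul0r addr0.
  exact: std_normal_integral_cst.
have tp : 0 < t by rewrite lt_neqAle eq_sym tN0.
apply: std_normal_convolution => //.
rewrite lt_neqAle eq_sym r0 andbT; apply/eqP => rz; move: rst.
rewrite rz expr0n => /eqP; rewrite eq_sym paddr_eq0 ?sqr_ge0// !expf_eq0/=.
by rewrite (negbTE tN0) andbF.
Qed.

(** A centred normal law is known from its variance, so the law of a sum of two
    independent such variables is known from the sum of the variances. *)
Lemma centered_normal_sum_eq U V U' V' s t s' t' f :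
  measurable_fun setT U -> measurable_fun setT V ->
  measurable_fun setT U' -> measurable_fun setT V' ->
  centered_normal U s -> centered_normal V t ->
  centered_normal U' s' -> centered_normal V' t' ->
  (\int[P]_w (U w ^+ 2)%:E + \int[P]_w (V w ^+ 2)%:E
   = \int[P]_w (U' w ^+ 2)%:E + \int[P]_w (V' w ^+ 2)%:E)%E ->
  continuous f -> (forall x, 0 <= f x) ->
  (\int[P]_w \int[P]_w' (f (U w + V w'))%:E
   = \int[P]_w \int[P]_w' (f (U' w + V' w'))%:E)%E.
Proof.
move=> mU mV mU' mV' lU lV lU' lV' var cf f0.
pose r := Num.sqrt (s ^+ 2 + t ^+ 2).
have r0 : 0 <= r by exact: sqrtr_ge0.
have rE : r ^+ 2 = s ^+ 2 + t ^+ 2 by rewrite sqr_sqrtr// addr_ge0// sqr_ge0.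
have rE' : r ^+ 2 = s' ^+ 2 + t' ^+ 2.
  move: var; rewrite rE !(centered_normal_sqr lU, centered_normal_sqr lV,
    centered_normal_sqr lU', centered_normal_sqr lV').
  have := std_normal_sqr_gt0 (R := R); have := std_normal_sqr_lty (R := R).
  case: std_normal_sqr => [c| |]// _; rewrite lte_fin => c0.
  rewrite -!EFinM -!EFinD -!mulrDl => -[]; apply: mulIf.
  by rewrite gt_eqF.
rewrite (centered_normal_sum mU mV lU lV r0 rE cf f0).
by rewrite (centered_normal_sum mU' mV' lU' lV' r0 rE' cf f0).
Qed.

End independent_sum.

(** * Measures determined by trigonometric functions *)

Section indicator_of_positivity.
Context {R : realType}.
Implicit Types y : R.

Lemma bernoulli_ge y n : 0 <= 1 + y -> 1 + n%:R * y <= (1 + y) ^+ n.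
Proof.
move=> y1; elim: n => [|n IH]; first by rewrite mul0r addr0 expr0.
rewrite exprS; apply: (@le_trans _ _ ((1 + y) * (1 + n%:R * y))).
  rewrite -natr1; have := sqr_ge0 y; have : (0 : R) <= n%:R by []; nra.
exact: ler_wpM2l.
Qed.

(** A sequence of polynomials tending, pointwise on [-1, 1], to the indicator of
    the positive reals.  With [z = (1 + y) / 2], the power [(1 - z ^+ n) ^+ (2 ^ n)]
    behaves as the exponential of [- (1 + y) ^+ n], so it tends to 0 or to 1
    according to the sign of [y]; its limit at [y = 0] is neither, and the first
    factor is there to vanish at that point. *)
Definition pos_approx n y : R := (1 - (1 - y * y) ^+ n) *
  (1 - (1 - (2^-1 * 1 + 2^-1 * y) ^+ n) ^+ (2 ^ n)).

Lemma pos_approx_bound n y : `|y| <= 1 -> `|pos_approx n y| <= 1.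
Proof.
rewrite ler_norml => /andP[y1 y2].
have h (z : R) k : 0 <= z <= 1 -> 0 <= 1 - z ^+ k <= 1.
  case/andP=> z0 z1; have := exprn_ge0 k z0; have := exprn_ile1 k z0 z1; lra.
have /h-/(_ n)/andP[a0 a1] : 0 <= 1 - y * y <= 1 by nra.
have /h-/(_ n) : 0 <= 2^-1 * 1 + 2^-1 * y <= 1 by lra.
move=> /h-/(_ (2 ^ n)%N)/andP[b0 b1].
by rewrite ger0_norm ?mulr_ge0// mulr_ile1.
Qed.

Lemma pos_approx_cvg y : `|y| <= 1 ->
  pos_approx n y @[n --> \oo] --> ((0 < y)%R%:R : R).
Proof.
rewrite ler_norml => /andP[y1 y2].
have first_factor : y != 0 -> (1 - (1 - y * y) ^+ n) @[n --> \oo] --> (1 : R).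
  move=> yN0; rewrite -[X in _ --> X]subr0; apply: cvgB; first exact: cvg_cst.
  apply: cvg_expr; have : 0 < y * y by rewrite -expr2 exprn_even_gt0.
  by rewrite ltr_norml => ?; nra.
have g2 n : (2^-1 * 1 + 2^-1 * y) ^+ n *+ (2 ^ n) = (1 + y) ^+ n.
  rewrite -mulr_natr natrX -exprMn; congr (_ ^+ _); lra.
have g01 n : 0 <= (2^-1 * 1 + 2^-1 * y) ^+ n <= 1.
  by rewrite exprn_ge0 ?exprn_ile1//; lra.
rewrite /pos_approx; case: (ltgtP 0 y) => y0.
- rewrite -[X in _ --> X]mulr1; apply: cvgM; first by apply: first_factor; lra.
  rewrite -[X in _ --> X]subr0; apply: cvgB; first exact: cvg_cst.
  have lim0 : y^-1 * harmonic n @[n --> \oo] --> (0 : R).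
    by rewrite -[X in _ --> X](mulr0 y^-1); apply: cvgMr; exact: cvg_harmonic.
  apply: (squeeze_cvgr _ (cvg_cst 0) lim0); apply: nearW => n.
  have /andP[z0 z1] := g01 n; move: (g2 n) z0 z1.
  set z := _ ^+ n => zE z0 z1; rewrite exprn_ge0 ?subr_ge0//=.
  rewrite /harmonic -invfM -[leRHS]mul1r ler_pdivlMr ?mulr_gt0//.
  (* Multiply by [(1 + z) ^+ (2 ^ n)], which is large by Bernoulli. *)
  have ny : y * n.+1%:R <= 1 + (2 ^ n)%:R * z.
    rewrite mulr_natl zE; have := bernoulli_ge n (y := y); rewrite -natr1.
    have : (0 : R) <= n%:R by []; nra.
  apply: (@le_trans _ _ ((1 - z) ^+ (2 ^ n) * (1 + z) ^+ (2 ^ n))).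
    rewrite ler_wpM2l ?exprn_ge0 ?subr_ge0//.
    by rewrite (le_trans ny)// bernoulli_ge// addr_ge0.
  by rewrite -exprMn exprn_ile1//; nra.
- apply: (squeeze_cvgr _ (cvg_cst 0) (_ : (1 + y) ^+ n @[n --> \oo] --> 0)).
    apply: nearW => n; have /andP[z0 z1] := g01 n; move: (g2 n) z0 z1.
    set z := _ ^+ n => zE z0 z1.
    have a0 : 0 <= (1 - y * y) ^+ n by rewrite exprn_ge0//; nra.
    have a1 : (1 - y * y) ^+ n <= 1 by rewrite exprn_ile1//; nra.
    have b0 : 0 <= (1 - z) ^+ (2 ^ n) by rewrite exprn_ge0// subr_ge0.
    have b1 : (1 - z) ^+ (2 ^ n) <= 1 by rewrite exprn_ile1// ?subr_ge0//; lra.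
    have := bernoulli_ge (2 ^ n) (y := - z); rewrite mulrN mulr_natl zE.
    by move=> b2; apply/andP; split; nra.
  by apply: cvg_expr; rewrite ltr_norml; lra.
- apply: cvg_near_cst; apply: nearW => n.
  by rewrite -y0 mul0r subr0 expr1n subrr mul0r.
Qed.

End indicator_of_positivity.

Section trig_class.
Context d (S : measurableType d) (R : realType) (L : set (S -> R)).
Hypothesis mL : forall Z, L Z -> measurable_fun setT Z.
Hypothesis L0 : L (fun=> 0).
Hypothesis Llin : forall a b Z Z', L Z -> L Z' -> L (fun x => a * Z x + b * Z' x).
Implicit Types (f g : S -> R) (C : set S).

(** Two probabilities which give the same integral to all these cosines give the
    same integral to every member of the class, and the rules are rich enough to
    reach the indicators of the events determined by [L]. *)
Inductive trig_class : (S -> R) -> Prop :=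
| trig_cos Z theta : L Z -> trig_class (fun x => cos (Z x + theta))
| trig_lin a b f g : trig_class f -> trig_class g ->
    trig_class (fun x => a * f x + b * g x)
| trig_lim (f_ : nat -> S -> R) g (M : R) : (forall n, trig_class (f_ n)) ->
    (forall n x, `|f_ n x| <= M) ->
    (forall x, f_ n x @[n --> \oo] --> g x) -> trig_class g.

Lemma trig_class_bound f : trig_class f -> exists M, forall x, `|f x| <= M.
Proof.
elim=> [Z t _|a b {}f g _ [M fM] _ [N gN]|f_ g M _ _ fM lim].
- by exists 1 => x; exact: cos_max.
- exists (`|a| * M + `|b| * N) => x.
  rewrite (le_trans (ler_normD _ _))// !normrM lerD// ler_wpM2l//.
- exists M => x.
  by apply: (ler_cvg_to (cvg_norm (lim x)) (cvg_cst M)); apply: nearW => n; exact: fM.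
Qed.

Lemma trig_class_measurable f : trig_class f -> measurable_fun setT f.
Proof.
elim=> [Z t LZ|a b {}f g _ mf _ mg|f_ g M _ mf _ lim].
- have mcos : measurable_fun [set: R] (@cos R).
    by apply: continuous_measurable_fun; exact: continuous_cos.
  apply: (measurableT_comp mcos).
  by apply: measurable_funD => //; exact: mL.
- by apply: measurable_funD; exact: measurable_funM.
- by apply: (measurable_fun_cvg mf) => x _; exact: lim.
Qed.

Lemma trig_cst (a : R) : trig_class (fun=> a).
Proof.
have := trig_lin a 0 (trig_cos 0 L0) (trig_cos 0 L0).
by under eq_fun do rewrite addr0 cos0 mulr1 mul0r addr0.
Qed.

(** A product of two cosines is a sum of two cosines; the other rules commute
    with a multiplication by a fixed member of the class. *)
Lemma trig_mul f g : trig_class f -> trig_class g -> trig_class (fun x => f x * g x).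
Proof.
move=> tf; elim: tf g => [Z t LZ|a b {}f f' _ IH _ IH'|f_ f' M tf_ IH fM lim] g tg.
- elim: tg => [Z' t' LZ'|a b {}g g' _ IH _ IH'|g_ g' M tg_ IH gM lim].
  + have -> : (fun x => cos (Z x + t) * cos (Z' x + t')) =
        (fun x => 2^-1 * cos ((1 * Z x + 1 * Z' x) + (t + t'))
                + 2^-1 * cos ((1 * Z x + (-1) * Z' x) + (t - t'))).
      apply/funext => x.
      have -> : 1 * Z x + 1 * Z' x + (t + t') = (Z x + t) + (Z' x + t') by ring.
      have -> : 1 * Z x + -1 * Z' x + (t - t') = (Z x + t) - (Z' x + t') by ring.
      by move: (Z x + t) (Z' x + t') => A B; rewrite cosD cosB; field.
    by apply: trig_lin; apply: trig_cos; exact: Llin.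
  + have -> : (fun x => cos (Z x + t) * (a * g x + b * g' x)) =
        (fun x => a * (cos (Z x + t) * g x) + b * (cos (Z x + t) * g' x)).
      by apply/funext => x; ring.
    exact: trig_lin.
  + apply: (@trig_lim (fun n x => cos (Z x + t) * g_ n x) _ M) => //.
      by move=> n x; rewrite normrM -[M]mul1r ler_pM// cos_max.
    by move=> x; apply: cvgM; [exact: cvg_cst|exact: lim].
- have -> : (fun x => (a * f x + b * f' x) * g x) =
      (fun x => a * (f x * g x) + b * (f' x * g x)).
    by apply/funext => x; ring.
  by apply: trig_lin; [exact: IH|exact: IH'].
- have [N gN] := trig_class_bound tg.
  apply: (@trig_lim (fun n x => f_ n x * g x) _ (M * N)).
  + by move=> n; exact: IH.
  + by move=> n x; rewrite normrM ler_pM.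
  + by move=> x; apply: cvgM; [exact: lim|exact: cvg_cst].
Qed.

Lemma trig_exp f n : trig_class f -> trig_class (fun x => f x ^+ n).
Proof.
move=> tf; elim: n => [|n IH]; first exact: trig_cst.
by under eq_fun do rewrite exprS; exact: trig_mul.
Qed.

Lemma trig_onem f : trig_class f -> trig_class (fun x => 1 - f x).
Proof.
move=> tf; have := trig_lin 1 (-1) (trig_cst 1) tf.
by under eq_fun do rewrite mulr1 mulN1r.
Qed.

Lemma trig_pos f : trig_class f -> (forall x, `|f x| <= 1) ->
  trig_class (fun x => (0 < f x)%R%:R).
Proof.
move=> tf f1; apply: (@trig_lim (fun n x => pos_approx n (f x)) _ 1).
- move=> n; apply: trig_mul; apply: trig_onem.
    by apply: trig_exp; apply: trig_onem; exact: trig_mul.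
  apply: trig_exp; apply: trig_onem; apply: trig_exp.
  by apply: trig_lin => //; exact: trig_cst.
- by move=> n x; exact: pos_approx_bound.
- by move=> x; exact: pos_approx_cvg.
Qed.

(** For [n] large [(Z x - a) / n] lies between [- pi] and [pi], where the sine
    has the sign of its argument. *)
Lemma trig_ray Z (a : R) : L Z -> trig_class (\1_[set x | a < Z x]).
Proof.
move=> LZ; pose c n : R := n.+1%:R^-1.
(* The sine, in the shape which [Llin] and [trig_cos] produce. *)
pose f n x : R := cos ((c n * Z x + 0 * 0) + (- (c n * a) - pi / 2)).
have fE n x : f n x = sin ((Z x - a) / n.+1%:R).
  rewrite -cosBpihalf /f; congr cos; rewrite /c; ring.
apply: (@trig_lim (fun n x => (0 < f n x)%R%:R) _ 1).
- move=> n; apply: trig_pos; last by move=> x; exact: cos_max.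
  exact/trig_cos/Llin.
- by move=> n x; rewrite normr_nat; case: (0 < _).
move=> x; apply: cvg_near_cst; near=> n.
have small : `|(Z x - a) / n.+1%:R| < pi.
  rewrite normrM normfV normr_nat ltr_pdivrMr// mulrC -ltr_pdivrMr ?pi_gt0//.
  apply: (@lt_trans _ _ n%:R); last by rewrite ltr_nat.
  near: n; exact: nbhs_infty_gtr.
rewrite fE indicE; congr ((nat_of_bool _)%:R); apply/idP/idP; last first.
  rewrite inE/= -subr_gt0 => Za; apply: sin_gt0_pi.
  rewrite divr_gt0//=; apply: le_lt_trans small; exact: ler_norm.
rewrite inE/=; apply: contraLR; rewrite -!leNgt -subr_le0 -oppr_ge0 => Za.
rewrite -oppr_ge0 -sinN -mulNr sin_ge0_pi// divr_ge0//=.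
by rewrite mulNr ltW// (le_lt_trans _ small)// -normrN ler_norm.
Unshelve. all: by end_near.
Qed.

Lemma trig_sigma_algebra : sigma_algebra setT [set C | trig_class (\1_C)].
Proof.
have tI C D : trig_class (\1_C) -> trig_class (\1_D) -> trig_class (\1_(C `&` D)).
  by move=> tC tD; rewrite indicI; exact: trig_mul.
have tC C : trig_class (\1_C) -> trig_class (\1_(~` C)).
  move=> /trig_onem; rewrite indicC; congr trig_class; apply/funext => x.
  by rewrite indicE; case: (x \in C); rewrite ?subrr ?subr0.
split=> /=.
- by rewrite indic0; exact: trig_cst.
- by move=> C; rewrite setTD; exact: tC.
move=> C tCn.
have tU n : trig_class (\1_(\big[setU/set0]_(i < n) C i)).
  elim: n => [|n IH]; first by rewrite big_ord0 indic0; exact: trig_cst.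
  rewrite big_ord_recr/= -[X in \1_X]setCK setCU; apply: (tC _).
  by apply: (tI); apply: (tC _).
apply: (@trig_lim (fun n => \1_(\big[setU/set0]_(i < n) C i)) _ 1) => //.
  by move=> n x; rewrite indicE normr_nat; case: (_ \in _).
move=> x; apply: cvg_near_cst.
have [[k _ Ckx]|NCx] := pselect ((\bigcup_k C k) x).
  near=> n; rewrite !indicE !mem_set//; first by exists k.
  rewrite -bigcup_mkord; exists k => //=; near: n.
  exact: nbhs_infty_gt.
near=> n; rewrite !indicE !memNset//.
by apply: contra_not NCx; rewrite -bigcup_mkord => -[k _ Ckx]; exists k.
Unshelve. all: by end_near.
Qed.

Lemma trig_preimage Z (B : set R) : L Z -> measurable B ->
  trig_class (\1_(Z @^-1` B)).
Proof.
move=> LZ mB.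
have sa := sigma_algebra_image Z trig_sigma_algebra.
have : (@RGenOInfty.G R).-sigma.-measurable B.
  by rewrite -RGenOInfty.measurableE.
move=> /(smallest_sub sa); rewrite /image_set_system/= setTI; apply.
by move=> _ [a ->]; rewrite /image_set_system/= setTI preimage_itvoy; exact: trig_ray.
Qed.

(** The form [1 + cos] of the hypothesis makes the integrands nonnegative. *)
Section equal_measures.
Variables P Q : probability S R.
Hypothesis PQ : forall Z theta, L Z ->
  (\int[P]_x (1 + cos (Z x + theta))%:E = \int[Q]_x (1 + cos (Z x + theta))%:E)%E.

Lemma trig_integrable (mu : probability S R) f : trig_class f ->
  mu.-integrable setT (EFin \o f).
Proof.
move=> tf; have [M fM] := trig_class_bound tf.
apply: measurable_bounded_integrable => //.
- by rewrite (le_lt_trans (probability_le1 _ _))// ltry.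
- exact: trig_class_measurable.
exists M; split; first exact: num_real.
by move=> N MN x _ /=; rewrite (le_trans (fM x))// ltW.
Qed.

Lemma trig_eq_integral f : trig_class f ->
  (\int[P]_x (f x)%:E = \int[Q]_x (f x)%:E)%E.
Proof.
have cst_int (mu : probability S R) : (\int[mu]_x 1%:E = 1%:E :> \bar R)%E.
  by have := expectation_cst mu 1; rewrite unlock.
have linE (mu : probability S R) a b f1 f2 : trig_class f1 -> trig_class f2 ->
    (\int[mu]_x (a * f1 x + b * f2 x)%:E
     = a%:E * \int[mu]_x (f1 x)%:E + b%:E * \int[mu]_x (f2 x)%:E)%E.
  move=> tf tg.
  have itf := trig_integrable mu tf; have itg := trig_integrable mu tg.
  transitivity (\int[mu]_x (a%:E * (f1 x)%:E + b%:E * (f2 x)%:E))%E.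
    by apply: eq_integral => x _; rewrite EFinD !EFinM.
  rewrite (integralD measurableT (integrableZl measurableT a itf)
    (integrableZl measurableT b itg)).
  by rewrite (integralZl measurableT itf) (integralZl measurableT itg).
have add1I (a b : \bar R) : (1%:E + a = 1%:E + b)%E -> a = b.
  by case: a b => [a| |] [b| |]//= [] /addrI ->.
elim=> [Z t LZ|a b {}f g tf IHf tg IHg|f_ g M tf IH fM lim].
- have E (mu : probability S R) : (\int[mu]_x (1 + cos (Z x + t))%:E
      = 1%:E + \int[mu]_x (cos (Z x + t))%:E)%E.
    have := linE mu 1 1 _ _ (trig_cst 1) (trig_cos t LZ).
    rewrite cst_int !mul1e => <-.
    by apply: eq_integral => x _; rewrite !mul1r.
  by have := PQ t LZ; rewrite !E; exact: add1I.
- by rewrite !linE// IHf IHg.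
have dc (mu : probability S R) :
    (\int[mu]_x (f_ n x)%:E)%E @[n --> \oo] --> (\int[mu]_x (g x)%:E)%E.
  have tg := trig_lim tf fM lim.
  have [|||||_ _] := @dominated_convergence _ _ _ mu _ measurableT
    (fun n x => (f_ n x)%:E) (EFin \o g) (cst M%:E).
  - by move=> n; apply/measurable_EFinP; exact: trig_class_measurable.
  - by apply/measurable_EFinP; exact: trig_class_measurable.
  - apply: aeW => x _; apply: cvg_EFin; last exact: lim.
    by apply: nearW.
  - exact: finite_measure_integrable_cst.
  - by apply: aeW => x n _; rewrite lee_fin.
  - exact.
have dP := dc P; rewrite (_ : (fun n => _) = (fun n => \int[Q]_x (f_ n x)%:E)%E) in dP.
  exact: (cvg_unique _ dP (dc Q)).
by apply/funext => n; exact: IH.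
Qed.

Lemma trig_eq_measure C : measurable C -> trig_class (\1_C) -> P C = Q C.
Proof.
move=> mC /trig_eq_integral; rewrite !integral_indic//.
by rewrite !setIT.
Qed.

End equal_measures.

End trig_class.

(** * Rotation invariance of a pair of independent Gaussian paths *)

(** An integral is the difference of those of the positive and negative parts,
    and this difference is infinite as soon as one of the two is. *)
Lemma integrable_of_integral d (S : measurableType d) (R : realType)
    (mu : {measure set S -> \bar R}) (f : S -> \bar R) : measurable_fun setT f ->
  (\int[mu]_x f x)%E \is a fin_num -> mu.-integrable setT f.
Proof.
move=> mf; rewrite integralE => fin; apply/integrableP; split => //.
rewrite [X in (X < _)%E](_ : _ = \int[mu]_x (f^\+ x + f^\- x))%E; last first.
  by apply: eq_integral => x _; have := congr1 (@^~ x) (fune_abse f).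
have p0 : (0 <= \int[mu]_x (f^\+ x))%E by exact: integral_ge0.
have n0 : (0 <= \int[mu]_x (f^\- x))%E by exact: integral_ge0.
rewrite ge0_integralD//; last 2 first.
- exact: measurable_funepos.
- exact: measurable_funeneg.
have key (a b : \bar R) : (0 <= a -> 0 <= b -> a - b \is a fin_num -> a + b < +oo)%E.
  by case: a b => [a| |] [b| |]// _ _ _; rewrite -EFinD ltry.
exact: key.
Qed.

Section coordinate_span.
Context {R : realType} {T : R} (W : pathSpace T).
Notation Omega := (pathOmega W).
Notation X := (canonical_process (W := W)).
Implicit Types (Z : Omega -> R) (a b : R).

Definition coord_span : set (Omega -> R) := [set Z | exists n (a t : 'I_n -> R),
  (forall i, `[0, T]%classic (t i)) /\ Z = (fun w => \sum_(i < n) a i * X (t i) w)].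

Lemma coord_span0 : coord_span (fun=> 0).
Proof.
exists 0%N, (fun=> 0), (fun=> 0); split; first by case.
by apply/funext => w; rewrite big_ord0.
Qed.

Lemma coord_span_lin a b Z Z' : coord_span Z -> coord_span Z' ->
  coord_span (fun w => a * Z w + b * Z' w).
Proof.
move=> [n [c [t [tI ->]]]] [m [c' [t' [tI' ->]]]].
exists (n + m)%N,
  (fun i => match fintype.split i with inl j => a * c j | inr j => b * c' j end),
  (fun i => match fintype.split i with inl j => t j | inr j => t' j end).
split; first by move=> i; case: fintype.splitP.
apply/funext => w; rewrite big_split_ord/= !mulr_sumr; congr (_ + _).
  by apply: eq_bigr => i _; rewrite (unsplitK (inl i)) mulrA.
by apply: eq_bigr => i _; rewrite (unsplitK (inr i)) mulrA.
Qed.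

Lemma coord_span1 t : `[0, T]%classic t -> coord_span (X t).
Proof.
move=> tT; exists 1%N, (fun=> 1), (fun=> t); split => //.
by apply/funext => w; rewrite big_ord1 mul1r.
Qed.

Lemma measurable_coord_span Z : coord_span Z -> measurable_fun setT Z.
Proof.
move=> [n [c [t [tI ->]]]]; apply: measurable_sum => i.
by apply: measurable_funM => //; exact: measurable_canonical_process.
Qed.

Definition path_comb a b (p : Omega * Omega) : Omega :=
  SigSub (mem_set (pathsD (pathsZ a (set_valP p.1)) (pathsZ b (set_valP p.2)))).

Lemma canonical_path_comb a b p t : X t (path_comb a b p) = a * X t p.1 + b * X t p.2.
Proof. by []. Qed.

Lemma coord_span_comb Z a b p : coord_span Z ->
  Z (path_comb a b p) = a * Z p.1 + b * Z p.2.
Proof.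
move=> [n [c [t [_ ->]]]]; rewrite !mulr_sumr -big_split/=.
by apply: eq_bigr => i _; rewrite canonical_path_comb; ring.
Qed.

Lemma measurable_path_comb a b : measurable_fun setT (path_comb a b).
Proof.
apply: (@measurability _ _ (Omega * Omega)%type Omega _ _ (coord_events (W := W))) => //.
move=> _ [_ [t tT [B mB <-]] <-].
rewrite !setTI -comp_preimage -[X in measurable X]setTI.
have : measurable_fun setT
    (fun p : Omega * Omega => a * X t p.1 + b * X t p.2).
  have mX := measurable_canonical_process (W := W) tT.
  apply: measurable_funD; apply: measurable_funM => //.
    exact: (measurableT_comp mX).
  exact: (measurableT_comp mX).
exact.
Qed.

(** Orthogonal when [a ^+ 2 + b ^+ 2 = 1], and then, being symmetric, its own
    inverse; a rotation up to a change of sign of the second path. *)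
Definition path_rot a b (p : Omega * Omega) : Omega * Omega :=
  (path_comb a b p, path_comb b (- a) p).

Lemma measurable_path_rot a b : measurable_fun setT (path_rot a b).
Proof. by apply: measurable_fun_pair; exact: measurable_path_comb. Qed.

HB.instance Definition _ a b :=
  isMeasurableFun.Build _ _ _ _ (path_rot a b) (measurable_path_rot a b).

Section gaussian.
Variables (P : probability Omega R) (g : R -> R -> R).
Hypothesis hP : centered_gaussian_process P `[0, T] X g.

Lemma integrable_canonical t : `[0, T]%classic t -> P.-integrable setT (EFin \o X t).
Proof.
move=> tT; have E := process_centered hP tT; rewrite unlock in E.
apply: integrable_of_integral; last by rewrite E.
by apply/measurable_EFinP; exact: measurable_canonical_process.
Qed.

Lemma coord_span_centered Z : coord_span Z ->
  P.-integrable setT (EFin \o Z) /\ (\int[P]_w (Z w)%:E = 0)%E.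
Proof.
move=> [n [c [t [tI ->]]]].
have iX i : P.-integrable setT (fun w => (c i)%:E * (X (t i) w)%:E)%E.
  by apply: integrableZl => //; exact: integrable_canonical.
have sumE w : ((\sum_(i < n) c i * X (t i) w)%:E
    = \sum_(i < n) (c i)%:E * (X (t i) w)%:E)%E.
  by rewrite -sumEFin; apply: eq_bigr => i _; rewrite EFinM.
split.
  rewrite [X in _.-integrable _ X](_ : _ =
    (fun w => \sum_(i < n) (c i)%:E * (X (t i) w)%:E)%E); last exact/funext.
  exact: integrable_sum.
under eq_integral do rewrite sumE.
rewrite integral_sum//= big1// => i _.
rewrite (integralZl measurableT (integrable_canonical (tI i))).
have := process_centered hP (tI i); rewrite unlock => ->.
by rewrite mule0.
Qed.

Lemma coord_span_normal Z : coord_span Z -> exists s, centered_normal P Z s.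
Proof.
move=> LZ; have [iZ EZ] := coord_span_centered LZ.
apply: centered_gaussian_rv_std => //; first exact: measurable_coord_span.
by case: LZ => n [c [t [tI ->]]]; exact: process_gaussian hP _ _ _ tI.
Qed.

Definition pair_span : set (Omega * Omega -> R) := [set F | exists Z Z',
  [/\ coord_span Z, coord_span Z' & F = (fun p => Z p.1 + Z' p.2)]].

Let measurable_pair_span F : pair_span F -> measurable_fun setT F.
Proof.
move=> [Z [Z' [LZ LZ' ->]]]; apply: measurable_funD.
  exact: (measurableT_comp (measurable_coord_span LZ)).
exact: (measurableT_comp (measurable_coord_span LZ')).
Qed.

Let pair_span0 : pair_span (fun=> 0).
Proof.
exists (fun=> 0), (fun=> 0); split; try exact: coord_span0.
by apply/funext => p; rewrite addr0.
Qed.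

Let pair_span_lin a b F F' : pair_span F -> pair_span F' ->
  pair_span (fun p => a * F p + b * F' p).
Proof.
move=> [Z1 [Z2 [L1 L2 ->]]] [Z1' [Z2' [L1' L2' ->]]].
exists (fun w => a * Z1 w + b * Z1' w), (fun w => a * Z2 w + b * Z2' w).
split; try exact: coord_span_lin.
by apply/funext => p; ring.
Qed.

(** The product sigma-algebra is generated by the coordinates of both paths. *)
Let trig_pair C : measurable C -> trig_class pair_span (\1_C).
Proof.
have sa := trig_sigma_algebra pair_span0 pair_span_lin.
have gen (h : Omega * Omega -> Omega) :
    (forall t, `[0, T]%classic t -> pair_span (X t \o h)) ->
    forall A : set Omega, measurable A -> trig_class pair_span (\1_(h @^-1` A)).
  move=> hX A mA.
  have := smallest_sub (sigma_algebra_image h sa) _ mA.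
  rewrite /image_set_system/= setTI; apply.
  move=> _ [t tT [B mB <-]]; rewrite /image_set_system/= !setTI -comp_preimage.
  exact: (trig_preimage pair_span0 pair_span_lin (hX t tT)).
move=> mC.
suff sub : preimage_set_system setT (@fst Omega Omega) measurable `|`
    preimage_set_system setT (@snd Omega Omega) measurable `<=`
    [set C | trig_class pair_span (\1_C)] 
  by have := smallest_sub sa sub; apply; have := mC; exact.
move=> _ [[A mA <-]|[A mA <-]]; rewrite setTI; apply: gen => // t tT.
  exists (X t), (fun=> 0); split; [exact: coord_span1|exact: coord_span0|].
  by apply/funext => p; rewrite /= addr0.
exists (fun=> 0), (X t); split; [exact: coord_span0|exact: coord_span1|].
by apply/funext => p; rewrite /= add0r.
Qed.

(** Rotating a pair of independent copies of a centred Gaussian process does not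
    change their joint law: linear functionals of the pair keep their variance,
    because the rotation preserves the sum of two squares. *)
Lemma path_rot_invariant a b C : a ^+ 2 + b ^+ 2 = 1 -> measurable C ->
  (P \x P)%E (path_rot a b @^-1` C) = (P \x P)%E C.
Proof.
move=> ab1 mC.
suff : distribution (P \x P)%E (path_rot a b) C = (P \x P)%E C by [].
apply: (trig_eq_measure measurable_pair_span pair_span0 _ mC (trig_pair mC)).
move=> F theta [Z [Z' [LZ LZ' ->]]].
(* [1 + cos] rather than [cos], to integrate nonnegative functions. *)
pose f (y : R) := 1 + cos (y + theta).
have f0 y : 0 <= f y by rewrite /f; have := cos_geN1 (y + theta); lra.
have Ef0 y : (0 <= (f y)%:E)%E by rewrite lee_fin.
have cf : continuous f.
  move=> y; apply: cvgD; first exact: cvg_cst.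
  apply: (continuous_comp (f := fun y => y + theta)); last exact: continuous_cos.
  by apply: cvgD; [exact: cvg_id|exact: cvg_cst].
have mf : measurable_fun [set: R] f by exact: continuous_measurable_fun.
have mZ := measurable_coord_span LZ; have mZ' := measurable_coord_span LZ'.
have mpair (Y Y' : Omega -> R) : measurable_fun setT Y -> measurable_fun setT Y' ->
    measurable_fun [set: Omega * Omega] (fun p => (f (Y p.1 + Y' p.2))%:E).
  move=> mY mY'; apply/measurable_EFinP; apply: (measurableT_comp mf).
  apply: measurable_funD; first exact: (measurableT_comp mY).
  exact: (measurableT_comp mY').
rewrite ge0_integral_distribution; last 2 first.
- exact: mpair.
- by move=> p; exact: Ef0.
pose U w := a * Z w + b * Z' w; pose V w := b * Z w + (- a) * Z' w.
have LU : coord_span U by exact: coord_span_lin.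
have LV : coord_span V by exact: coord_span_lin.
have mU := measurable_coord_span LU; have mV := measurable_coord_span LV.
transitivity (\int[(P \x P)%E]_p (f (U p.1 + V p.2))%:E)%E.
  apply: eq_integral => p _; rewrite /= !coord_span_comb// /f /U /V.
  by congr (1 + cos _)%:E; ring.
rewrite (fubini_tonelli1 (m1 := P) (m2 := P) _ (mpair _ _ mU mV) (fun=> Ef0 _)).
rewrite (fubini_tonelli1 (m1 := P) (m2 := P) _ (mpair _ _ mZ mZ') (fun=> Ef0 _)).
have [s lZ] := coord_span_normal LZ; have [t lZ'] := coord_span_normal LZ'.
have [u lU] := coord_span_normal LU; have [v lV] := coord_span_normal LV.
apply: (centered_normal_sum_eq mU mV mZ mZ' lU lV lZ lZ' _ cf f0).
have msq (Y : Omega -> R) : measurable_fun setT Y ->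
    measurable_fun setT (fun w => (Y w ^+ 2)%:E).
  by move=> mY; apply/measurable_EFinP; exact: measurable_funX.
have sq0 (Y : Omega -> R) w : setT w -> (0 <= (Y w ^+ 2)%:E)%E.
  by rewrite lee_fin sqr_ge0.
rewrite -(ge0_integralD P measurableT (sq0 U) (msq U mU) (sq0 V) (msq V mV)).
rewrite -(ge0_integralD P measurableT (sq0 Z) (msq Z mZ) (sq0 Z') (msq Z' mZ')).
apply: eq_integral => w _; rewrite -!EFinD /U /V; congr EFin.
transitivity ((a ^+ 2 + b ^+ 2) * (Z w ^+ 2 + Z' w ^+ 2)); first by ring.
by rewrite ab1 mul1r.
Qed.

Lemma ge0_integral_path_rot a b (F : Omega * Omega -> \bar R) :
  a ^+ 2 + b ^+ 2 = 1 -> measurable_fun setT F -> (forall p, (0 <= F p)%E) ->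
  (\int[P]_w \int[P]_w' F (path_rot a b (w, w'))
   = \int[P]_w \int[P]_w' F (w, w'))%E.
Proof.
move=> ab1 mF F0.
have mFr : measurable_fun setT (F \o path_rot a b).
  exact: (measurableT_comp mF (@measurable_path_rot a b)).
rewrite -(fubini_tonelli1 (m1 := P) (m2 := P) _ mFr (fun=> F0 _)).
rewrite -(fubini_tonelli1 (m1 := P) (m2 := P) _ mF F0).
rewrite -(ge0_integral_distribution (path_rot a b) mF F0).
apply: eq_measure_integral => A mA _; exact: path_rot_invariant.
Qed.

End gaussian.

End coordinate_span.

(** * The Bayes lower bound *)

Section bayes_risk.
Local Open Scope ereal_scope.

Lemma bias_variance d (S : measurableType d) (R : realType) (P : probability S R)
    (Y : S -> R) (a b : R) : P.-integrable setT (EFin \o Y) ->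
  \int[P]_w (Y w)%:E = 0 -> P.-integrable setT (fun w => (Y w ^+ 2)%:E) ->
  \int[P]_w ((a + b * Y w) ^+ 2)%:E
  = (a ^+ 2)%:E + (b ^+ 2)%:E * \int[P]_w (Y w ^+ 2)%:E.
Proof.
move=> iY EY iY2.
have icst : P.-integrable setT (cst (a ^+ 2)%:E).
  exact: finite_measure_integrable_cst.
have iZ := integrableZl measurableT (2 * a * b)%R iY.
have iZ2 := integrableZl measurableT (b ^+ 2)%R iY2.
transitivity (\int[P]_w ((a ^+ 2)%:E +
    ((2 * a * b)%:E * (Y w)%:E + (b ^+ 2)%:E * (Y w ^+ 2)%:E))).
  by apply: eq_integral => w _; rewrite -!EFinM -!EFinD; congr EFin; ring.
rewrite (integralD measurableT icst (integrableD measurableT iZ iZ2)).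
rewrite (integralD measurableT iZ iZ2) (integralZl measurableT iY).
rewrite (integralZl measurableT iY2) EY mule0 add0e; congr (_ + _).
by have := expectation_cst P (a ^+ 2)%R; rewrite unlock.
Qed.

(** Processes are measurable on a subset of the time axis only, so the theorem
    of Tonelli is applied to their extensions by 0. *)
Section tonelli_on_subset.
Context d1 d2 (S1 : measurableType d1) (S2 : measurableType d2) (R : realType).
Variables (mu : {sigma_finite_measure set S1 -> \bar R}).
Variables (P : {sigma_finite_measure set S2 -> \bar R}).
Variables (D : set S1) (mD : measurable D) (G : S1 * S2 -> \bar R).
Hypothesis mG : measurable_fun (D `*` setT) G.
Hypothesis G0 : forall q, 0 <= G q.

Let G' := G \_ (D `*` setT).

Let mG' : measurable_fun setT G'.
Proof. by apply/(measurable_restrictT _ _).1 => //; exact: measurableX. Qed.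

Let G'0 q : 0 <= G' q.
Proof. by rewrite /G' patchE; case: ifPn. Qed.

Let G'E t s : G' (t, s) = ((fun t => G (t, s)) \_ D) t.
Proof.
rewrite /G' !patchE; case: (boolP (t \in D)) => tD.
  by rewrite mem_set//; split => //; exact: set_mem.
by rewrite memNset// => -[/= Dt _]; move: tD; rewrite mem_set.
Qed.

Let G'F s : \int[mu]_t G' (t, s) = \int[mu]_(t in D) G (t, s).
Proof. by rewrite [RHS]integral_mkcond; apply: eq_integral => t _; exact: G'E. Qed.

Lemma measurable_integral_subset :
  measurable_fun setT (fun s => \int[mu]_(t in D) G (t, s)).
Proof.
have := @measurable_fun_fubini_tonelli_G _ _ _ _ _ mu _ mG' G'0.
by congr measurable_fun; apply/funext => s; exact: G'F.
Qed.

Lemma measurable_integral_section : measurable_fun D (fun t => \int[P]_s G (t, s)).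
Proof.
have := @measurable_fun_fubini_tonelli_F _ _ _ _ _ P _ mG' G'0.
move/(measurable_funS measurableT (@subsetT _ D)).
apply: eq_measurable_fun => t tD; apply: eq_integral => s _.
by rewrite G'E patchE tD.
Qed.

Lemma tonelli_subset :
  \int[P]_s \int[mu]_(t in D) G (t, s) = \int[mu]_(t in D) \int[P]_s G (t, s).
Proof.
transitivity (\int[P]_s \int[mu]_t G' (t, s)).
  by apply: eq_integral => s _; rewrite G'F.
rewrite -(fubini_tonelli (m1 := mu) (m2 := P) _ mG' G'0) [RHS]integral_mkcond.
apply: eq_integral => t _; rewrite patchE; case: ifPn => tD.
  by apply: eq_integral => s _; rewrite G'E patchE tD.
by rewrite integral0_eq// => s _; rewrite G'E patchE (negbTE tD).
Qed.

End tonelli_on_subset.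

Section minimax.
Context {R : realType} {T : R} (W : pathSpace T).
Variables (mu : {finite_measure set (measurableTypeR R) -> \bar R}).
Notation Omega := (pathOmega W).
Notation X := (canonical_process (W := W)).
Notation D := (`[0%R, T]%classic : set R).
Variables (P : probability Omega R) (g : R -> R -> R).
Hypothesis hX : measurable_process X.
Hypothesis hP : centered_gaussian_process P D X g.
Implicit Types (xi : R -> Omega -> R) (u v w : Omega) (a b c : R).

Lemma path_ext (w w' : Omega) : (forall t, X t w = X t w') -> w = w'.
Proof. by move=> ww'; apply/val_inj/funext. Qed.

Lemma measurable_process_comp d (S : measurableType d) xi (h : S -> Omega) :
  measurable_process xi -> measurable_fun setT h ->
  measurable_fun (D `*` [set: S]) (fun q : measurableTypeR R * S => xi q.1 (h q.2)).
Proof.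
move=> mxi mh.
pose k (q : measurableTypeR R * S) := (q.1, h q.2).
have mk : measurable_fun (D `*` [set: S]) k.
  apply: measurable_funTS; apply: measurable_fun_pair => //.
  exact: (measurableT_comp mh).
apply: (measurable_comp _ _ mxi mk).
- by apply: measurableX => //; exact: measurable_itv.
- by move=> _ [[t s] [/= tD _] <-].
Qed.

Lemma measurable_loss d (S : measurableType d) xi (h h' : S -> Omega) c :
  measurable_process xi -> measurable_fun setT h -> measurable_fun setT h' ->
  measurable_fun (D `*` [set: S]) (fun q : measurableTypeR R * S =>
    (`|xi q.1 (h q.2) - c * X q.1 (h' q.2)| ^+ 2)%:E).
Proof.
move=> mxi mh mh'; apply/measurable_EFinP; apply: measurable_funX.
apply: measurableT_comp => //; apply: measurable_funB.
  exact: (measurable_process_comp mxi mh).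
by apply: measurable_funM => //; exact: (measurable_process_comp hX mh').
Qed.

Let sq_ge0 (x : R) : 0 <= (`|x| ^+ 2)%:E.
Proof. by rewrite lee_fin exprn_ge0. Qed.

Lemma riskE xi v : measurable_process xi ->
  risk P mu xi v = \int[P]_w \int[mu]_(t in D)
    (`|xi t (shift_path v w) - X t v| ^+ 2)%:E.
Proof.
move=> mxi; rewrite /risk /translated ge0_integral_distribution//.
  have mv : measurable_fun [set: Omega] (fun=> v) by exact: measurable_cst.
  have mid : measurable_fun [set: Omega] id by exact: measurable_id.
  have := measurable_integral_subset mu (measurable_itv _)
    (measurable_loss 1 mxi mid mv) (fun=> sq_ge0 _).
  by under eq_fun do under eq_integral do rewrite mul1r.
by move=> w; apply: integral_ge0.
Qed.

Lemma mean_square_canonical t : D t -> \int[P]_w (X t w ^+ 2)%:E = (g t t)%:E.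
Proof.
by move=> tD; have := process_cov hP tD tD; rewrite unlock.
Qed.

Lemma g_ge0 t : D t -> (0 <= g t t)%R.
Proof.
move=> tD; rewrite -lee_fin -mean_square_canonical//.
by apply: integral_ge0 => w _; rewrite lee_fin sqr_ge0.
Qed.

Lemma measurable_variance : measurable_fun D (fun t => (g t t)%:E).
Proof.
have mid : measurable_fun [set: Omega] id by exact: measurable_id.
have := measurable_integral_section P (measurable_itv _)
  (measurable_loss 0 hX mid mid) (fun=> sq_ge0 _).
apply: eq_measurable_fun => t /set_mem tD.
rewrite -mean_square_canonical//; apply: eq_integral => w _.
by rewrite mul0r subr0 real_normK// num_real.
Qed.

Lemma risk_canonical v : risk P mu X v = \int[mu]_(t in D) (g t t)%:E.
Proof.
rewrite (riskE _ hX).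
have mid : measurable_fun [set: Omega] id by exact: measurable_id.
have := tonelli_subset mu P (measurable_itv _) (measurable_loss 0 hX mid mid)
  (fun=> sq_ge0 _).
move=> E; transitivity (\int[P]_w \int[mu]_(t in D)
    (`|X t w - 0 * X t w| ^+ 2)%:E).
  apply: eq_integral => w _; apply: eq_integral => t _.
  by rewrite canonical_process_shift addrC addKr mul0r subr0.
rewrite [LHS]E; apply: eq_integral => t /set_mem tD.
rewrite -mean_square_canonical//; apply: eq_integral => w _.
by rewrite mul0r subr0 real_normK// num_real.
Qed.

Section bayes_bound.
Variables (a b : R).
Hypotheses (a0 : (0 < a)%R) (ab1 : (a ^+ 2 + b ^+ 2 = 1)%R).
Variable xi : R -> Omega -> R.
Hypothesis mxi : measurable_process xi.

Let c : R := (b / a)%R.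

Let aN0 : a != 0%R. Proof. by rewrite gt_eqF. Qed.

(** Here [q.2.1] is the noise and [c] times [q.2.2] the drift. *)
Let loss (q : measurableTypeR R * (Omega * Omega)) : \bar R :=
  (`|xi q.1 (path_comb 1 c q.2) - c * X q.1 q.2.2| ^+ 2)%:E.

Let measurable_loss_pair : measurable_fun (D `*` setT) loss.
Proof.
exact: (measurable_loss c mxi (@measurable_path_comb _ _ W 1 c) measurable_snd).
Qed.

(** For the rotated pair the observation is a multiple of the first path alone,
    so that the second one is a noise that no estimator sees. *)
Let loss_rot t w w' : loss (t, path_rot a b (w, w'))
  = ((xi t (path_comb a^-1 0 (w, w)) - c * b * X t w + b * X t w') ^+ 2)%:E.
Proof.
rewrite /loss /=; congr EFin; rewrite real_normK ?num_real//.
have -> : path_comb 1 c (path_rot a b (w, w')) = path_comb a^-1 0 (w, w).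
  apply: path_ext => s; rewrite !canonical_path_comb/=.
  have -> : (a^-1 = a + c * b)%R.
    apply: (mulIf aN0); rewrite mulVf// -ab1 /c; field.
    by rewrite aN0.
  by rewrite /c; field.
rewrite !canonical_path_comb/=; congr (_ ^+ 2)%R; rewrite /c; field.
by rewrite aN0.
Qed.

(** With the first rotated path fixed, the error of the estimator is a constant
    plus [b] times the centred variable [X t w'], and only the variance of the
    latter is kept. *)
Let loss_lb t : D t -> (b ^+ 2)%:E * (g t t)%:E <= \int[P \x P]_p loss (t, p).
Proof.
move=> tD.
have mlt : measurable_fun [set: Omega * Omega] (fun p => loss (t, p)).
  apply: (measurable_comp _ _ measurable_loss_pair (pair1_measurable t)).
  - by apply: measurableX => //; exact: measurable_itv.
  - by move=> _ [p _ <-].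
rewrite (fubini_tonelli1 (m1 := P) (m2 := P) _ mlt (fun=> sq_ge0 _)).
rewrite /fubini_F -(ge0_integral_path_rot hP ab1 mlt (fun=> sq_ge0 _)).
have [iX EX] := coord_span_centered hP (coord_span1 W tD).
have mX2 : measurable_fun [set: Omega] (fun w => (X t w ^+ 2)%:E).
  apply/measurable_EFinP; apply: measurable_funX.
  exact: measurable_canonical_process.
have iX2 : P.-integrable setT (fun w => (X t w ^+ 2)%:E).
  by apply: integrable_of_integral => //; rewrite mean_square_canonical.
have step w : (b ^+ 2)%:E * (g t t)%:E
    <= \int[P]_w' loss (t, path_rot a b (w, w')).
  under eq_integral do rewrite loss_rot.
  rewrite (bias_variance _ _ iX EX iX2) mean_square_canonical//.
  by rewrite leeDr// lee_fin sqr_ge0.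
rewrite -[leLHS](_ : \int[P]_w ((b ^+ 2)%:E * (g t t)%:E) = _); last first.
  by have := expectation_cst P (b ^+ 2 * g t t)%R; rewrite unlock.
apply: ge0_le_integral.
- exact: measurableT.
- by move=> w _; rewrite mule_ge0// ?lee_fin ?sqr_ge0// g_ge0.
- exact: measurable_cst.
- have mrot := measurableT_comp mlt (@measurable_path_rot _ _ W a b).
  exact: (@measurable_fun_fubini_tonelli_F _ _ _ _ _ P _ mrot (fun=> sq_ge0 _)).
- by move=> w _; exact: step.
Qed.

(** The supremum over drifts dominates the average over the random drift
    [c w'], where [w'] has law [P]. *)
Lemma bayes_bound : (b ^+ 2)%:E * \int[mu]_(t in D) (g t t)%:E
  <= ereal_sup [set risk P mu xi v | v in [set: Omega]].
Proof.
set M := ereal_sup _.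
(* A combination with first coefficient 0 is a mere multiple. *)
pose drift (w' : Omega) : Omega := path_comb 0 c (w', w').
have riskM w' : risk P mu xi (drift w') <= M.
  by apply: ereal_sup_ubound; exists (drift w').
have riskP w' : risk P mu xi (drift w')
    = \int[P]_w \int[mu]_(t in D) loss (t, (w, w')).
  rewrite (riskE _ mxi); apply: eq_integral => w _; apply: eq_integral => t _.
  rewrite /loss /= canonical_path_comb/= mul0r add0r.
  congr (`|xi t _ - _| ^+ 2)%:E; apply: path_ext => s.
  by rewrite canonical_process_shift !canonical_path_comb/=; ring.
have mloss := measurable_integral_subset mu (measurable_itv _)
  measurable_loss_pair (fun=> sq_ge0 _).
have loss0 p : 0 <= \int[mu]_(t in D) loss (t, p).
  by apply: integral_ge0 => t _; exact: sq_ge0.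
have risk0 w' : 0 <= risk P mu xi (drift w').
  by rewrite riskP; apply: integral_ge0 => w _; exact: loss0.
have mrisk : measurable_fun setT (fun w' => risk P mu xi (drift w')).
  have := @measurable_fun_fubini_tonelli_G _ _ _ _ _ P _ mloss loss0.
  by congr measurable_fun; apply/funext => w'; rewrite riskP.
apply: (@le_trans _ _ (\int[P]_w' risk P mu xi (drift w'))); last first.
  apply: (@le_trans _ _ (\int[P]_w' M)).
    apply: ge0_le_integral.
    - exact: measurableT.
    - by move=> w' _; exact: risk0.
    - exact: mrisk.
    - exact: measurable_cst.
    - by move=> w' _; exact: riskM.
  rewrite integral_cst; last exact: measurableT.
  suff -> : M * P setT = M by [].
  by rewrite probability_setT mule1.
have -> : \int[P]_w' risk P mu xi (drift w')
    = \int[P \x P]_p \int[mu]_(t in D) loss (t, p).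
  rewrite (fubini_tonelli2 (m1 := P) (m2 := P) _ mloss loss0).
  by apply: eq_integral => w' _; exact: riskP.
pose PP : probability (Omega * Omega)%type R := (P \x P)%E.
have -> := tonelli_subset mu PP (measurable_itv _) measurable_loss_pair
  (fun=> sq_ge0 _).
have mg := measurable_variance.
have b2 : (0 <= b ^+ 2)%R by exact: sqr_ge0.
have gE0 t : D t -> 0 <= (g t t)%:E by move=> tD; rewrite lee_fin g_ge0.
rewrite -(ge0_integralZl_EFin mu (measurable_itv _) gE0 mg b2).
apply: ge0_le_integral.
- exact: measurable_itv.
- by move=> t tD; rewrite mule_ge0 ?lee_fin ?g_ge0.
- by apply: emeasurable_funM => //; exact: measurable_cst.
- exact: (measurable_integral_section PP (measurable_itv _)
    measurable_loss_pair (fun=> sq_ge0 _)).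
- exact: loss_lb.
Qed.

End bayes_bound.

End minimax.
End bayes_risk.

Theorem proposition3p2 (R : realType) (T : R) (T_gt0 : 0 < T)
  (mu : {finite_measure set (measurableTypeR R) -> \bar R})
  (K : R -> R -> R) (hK : drift_kernel T K)
  (W : pathSpace T) (hX : measurable_process (canonical_process (W := W)))
  (P : probability (pathOmega W) R)
  (hP : centered_gaussian_process P `[0, T] (canonical_process (W := W)) (kernel_cov K))
  (u : pathOmega W) :
  (\int[mu]_(t in `[0%R, T]) (kernel_cov K t t)%:E
     = risk P mu (canonical_process (W := W)) u)%E /\
  (risk P mu (canonical_process (W := W)) u
     = ereal_inf [set ereal_sup [set risk P mu xi v | v in [set: pathOmega W]]
                 | xi in [set xi | measurable_process xi]])%E.
Proof.
have canonical v := risk_canonical mu hX hP v.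
split; rewrite canonical//.
have I0 : (0 <= \int[mu]_(t in `[0%R, T]) (kernel_cov K t t)%:E)%E.
  by apply: integral_ge0 => t tT; rewrite lee_fin (g_ge0 hP tT).
apply/eqP; rewrite eq_le; apply/andP; split.
  apply: le_ereal_inf_tmp => _ [xi mxi <-]; apply/(lee_mul01Pr _ I0) => r /andP[r0 r1].
  (* [r] below 1 keeps [a] positive, that is, the prior scale [b / a] finite. *)
  pose b := Num.sqrt r; pose a := Num.sqrt (1 - r).
  have -> : r = b ^+ 2 by rewrite sqr_sqrtr// ltW.
  have a0 : 0 < a by rewrite sqrtr_gt0 subr_gt0.
  have ab1 : a ^+ 2 + b ^+ 2 = 1.
    by rewrite !sqr_sqrtr ?subrK// ?subr_ge0 ltW.
  exact: (bayes_bound mu hX hP a0 ab1 mxi).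
apply: ereal_inf_lbound; exists (canonical_process (W := W)) => //.
apply/eqP; rewrite eq_le; apply/andP; split.
  by apply: ge_ereal_sup => _ [v _ <-]; rewrite canonical.
by apply: ereal_sup_ubound; exists u => //; exact: canonical.
Qed.
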